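(* Let $\kappa$ be a weakly compact cardinal and assume $\mathrm{WC}^*_G$ holds. Then the quasi-orders $\sqsubseteq^{\mathrm{reg}}$ and $\sqsubseteq^{\mathrm{NS}}$ on $2^\kappa$ are $\Sigma^1_1$-complete.
   Context: $\kappa^\kappa$ carries the bounded topology (basic open sets $\{\eta\mid p\subset\eta\}$, $p\in\kappa^{<\kappa}$), $2^\kappa$ the subspace topology; Borel sets are generated from basic open sets by unions and intersections of length $\kappa$; a map between Borel subsets is Borel if preimages of open sets are Borel. A quasi-order $Q$ on a Borel $X\subseteq\kappa^\kappa$ is $\Sigma^1_1$ if it is the projection of a closed subset of $X^2\times\kappa^\kappa$; $Q_1$ on $X$ is Borel-reducible to $Q_2$ on $Y$ if some Borel $f\colon X\to Y$ satisfies $x_1Q_1x_2\iff f(x_1)Q_2f(x_2)$; a quasi-order is $\Sigma^1_1$-complete if every $\Sigma^1_1$ quasi-order is Borel-reducible to it. $\mathrm{reg}(\kappa)$ is the set of regular cardinals below $\kappa$. For $\eta,\xi\in2^\kappa$: $\eta\sqsubseteq^{\mathrm{reg}}\xi$ iff $(\eta^{-1}\{1\}\setminus\xi^{-1}\{1\})\cap\mathrm{reg}(\kappa)$ is non-stationary, and $\eta\sqsubseteq^{\mathrm{NS}}\xi$ iff $\eta^{-1}\{1\}\setminus\xi^{-1}\{1\}$ is non-stationary. Let $G_{<\kappa}=\{\mathcal{G}_\beta\}_{\beta<\kappa}$ enumerate all graphs whose domain is an ordinal $\alpha<\kappa$, and $G_{<\alpha}=\{\mathcal{G}_\beta\}_{\beta<\alpha}$.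 $\mathrm{WC}^*_G$ is the statement: there is a sequence $\langle f_\alpha\rangle_{\alpha<\kappa}$ with $f_\alpha\in(G_{<\alpha})^\alpha$ such that for every stationary $S\subseteq\kappa$ and every $g\in(G_{<\kappa})^\kappa$ the set $\{\alpha\in\mathrm{reg}(\kappa)\mid g\restriction\alpha=f_\alpha\wedge S\cap\alpha\text{ is stationary in }\alpha\}$ is stationary. *)

(* Defs.v *)
From HB Require Import structures.
From mathcomp Require Import all_boot all_order.
From mathcomp Require Import boolp classical_sets functions cardinality.
From mathcomp Require Import set_interval filter topology.

Set Implicit Arguments.
Unset Strict Implicit.
Unset Printing Implicit Defensive.

Import Order.TTheory.

Local Open Scope classical_set_scope.
Local Open Scope card_scope.

(* The cardinal kappa is a total order K with least element 0 = \bot; it is    *)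
(* required to be well-ordered in [cardinal_order].  The ordinals below kappa  *)
(* are the elements of K, and an ordinal a is identified with its set of       *)
(* predecessors [below a].                                                     *)

Section Cardinals.
Context {d : Order.disp_t} (K : bOrderType d).

Definition below (a : K) : set K := [set x | (x < a)%O].

(* The order type of K is an initial ordinal.                                  *)
Definition cardinal_order : Prop :=
  well_founded (fun x y : K => (x < y)%O) /\
  forall a : K, ~ ([set: K] #<= below a).

(* kappa is uncountable and kappa --> (kappa)^2_2.  A colouring of [kappa]^2   *)
(* is given by the values c x y with x < y; the other values are ignored.      *)
Definition weakly_compact : Prop :=
  [/\ cardinal_order,
      ~ countable [set: K]
    & forall c : K -> K -> bool, exists (H : set K) (i : bool),
        H #= [set: K] /\ forall x y, H x -> H y -> (x < y)%O -> c x y = i].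

(* In the definitions up to [stationary_in], A is an initial segment of K:     *)
(* either setT, i.e. kappa itself, or [below a], i.e. the ordinal a < kappa.   *)
Definition unbounded_in (A C : set K) : Prop :=
  forall x, A x -> exists2 y, C y & (x <= y)%O.

Definition limit_point (C : set K) (l : K) : Prop :=
  l <> \bot%O /\ forall x, (x < l)%O -> exists2 y, C y & (x < y < l)%O.

Definition club_in (A C : set K) : Prop :=
  [/\ C `<=` A, unbounded_in A C & forall l, A l -> limit_point C l -> C l].

Definition stationary_in (A S : set K) : Prop :=
  forall C, club_in A C -> S `&` C !=set0.

Definition stationary (S : set K) : Prop := stationary_in setT S.

(* a is an infinite cardinal all of whose cofinal subsets have cardinality a.  *)
Definition reg : set K := [set a |
  [/\ infinite_set (below a),
      (forall b, (b < a)%O -> ~ (below a #<= below b))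
    & forall A, A `<=` below a -> unbounded_in (below a) A ->
        below a #<= A]].

End Cardinals.

(* The space kappa^kappa; the alias keeps it apart from the topologies that    *)
(* the library puts on arrow types.                                            *)
Definition baire {d : Order.disp_t} (K : bOrderType d) : Type := K -> K.

HB.instance Definition _ d (K : bOrderType d) := gen_eqMixin (baire K).
HB.instance Definition _ d (K : bOrderType d) := gen_choiceMixin (baire K).

(* The node of kappa^{<kappa} is the restriction of p to a.                    *)
Definition cylinder {d} {K : bOrderType d} (p : baire K) (a : K) :
    set (baire K) :=
  [set eta | forall b, (b < a)%O -> eta b = p b].

Definition basic_open {d} {K : bOrderType d} (U : set (baire K)) : Prop :=
  exists (p : baire K) (a : K), U = cylinder p a.

Lemma basic_open_cover {d} (K : bOrderType d) :
  \bigcup_(U in @basic_open d K) U = setT.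
Proof.
rewrite -subTset => x _; exists (cylinder x \bot%O) => //.
by exists x, \bot%O.
Qed.

Lemma basic_open_join {d} (K : bOrderType d) (U V : set (baire K)) x :
  basic_open U -> basic_open V -> U x -> V x ->
  exists W, [/\ basic_open W, W x & W `<=` U `&` V].
Proof.
move=> [p [a ->]] [q [b ->]] px qx.
exists (cylinder x (Order.max a b)); split => //; first by exists x, (Order.max a b).
move=> y xy; split=> c ca.
- by rewrite xy ?px// lt_max ca.
- by rewrite xy ?qx// lt_max ca orbT.
Qed.

HB.instance Definition _ d (K : bOrderType d) :=
  isBaseTopological.Build (baire K) (@basic_open_cover d K) (@basic_open_join d K).

Section DescriptiveSetTheory.
Context {d : Order.disp_t} {K : bOrderType d}.
Local Notation B := (baire K).

Inductive borel : set B -> Prop :=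
| borel_basic U : basic_open U -> borel U
| borel_bigcup (F : K -> set B) :
    (forall i, borel (F i)) -> borel (\bigcup_i F i)
| borel_bigcap (F : K -> set B) :
    (forall i, borel (F i)) -> borel (\bigcap_i F i).

(* For Borel X and Y, the map X -> Y is the restriction of f; the preimages    *)
(* of the relatively open subsets U `&` Y of Y are the sets X `&` f @^-1` U.   *)
Definition borel_map (X Y : set B) (f : B -> B) : Prop :=
  (forall x, X x -> Y (f x)) /\
  forall U : set B, open U -> borel (X `&` f @^-1` U).

(* Relations on X are relations on kappa^kappa used at points of X only.       *)
Definition quasi_order (X : set B) (Q : B -> B -> Prop) : Prop :=
  (forall x, X x -> Q x x) /\
  forall x y z, X x -> X y -> X z -> Q x y -> Q y z -> Q x z.

(* The closed subsets of X^2 x kappa^kappa are the traces of the closed        *)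
(* subsets of (kappa^kappa)^3.                                                 *)
Definition Sigma11 (X : set B) (Q : B -> B -> Prop) : Prop :=
  exists2 C : set (B * B * B), closed C &
    forall x y, X x -> X y -> (Q x y <-> exists z, C (x, y, z)).

Definition borel_reducible (X1 : set B) (Q1 : B -> B -> Prop)
    (X2 : set B) (Q2 : B -> B -> Prop) : Prop :=
  exists2 f : B -> B, borel_map X1 X2 f &
    forall x y, X1 x -> X1 y -> (Q1 x y <-> Q2 (f x) (f y)).

Definition Sigma11_complete (Y : set B) (R : B -> B -> Prop) : Prop :=
  [/\ borel Y, quasi_order Y R
    & forall (X : set B) (Q : B -> B -> Prop),
        borel X -> quasi_order X Q -> Sigma11 X Q -> borel_reducible X Q Y R].

(* The ordinal 1.                                                              *)
Definition is_one (x : K) : Prop := forall y : K, (y < x)%O <-> y = \bot%O.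

(* 2^kappa as a subset of kappa^kappa.                                         *)
Definition cantor : set B := [set eta | forall i, eta i = \bot%O \/ is_one (eta i)].

Definition ones (eta : B) : set K := [set i | is_one (eta i)].

Definition sub_reg (eta xi : B) : Prop :=
  ~ stationary ((ones eta `\` ones xi) `&` @reg d K).

Definition sub_NS (eta xi : B) : Prop :=
  ~ stationary (ones eta `\` ones xi).

End DescriptiveSetTheory.

Section Graphs.
Context {d : Order.disp_t} (K : bOrderType d).

(* A simple graph whose vertex set is the ordinal gdom < kappa.                *)
Record graph : Type := Graph {
  gdom : K;
  edge : K -> K -> Prop;
  edge_gdom : forall x y, edge x y -> (x < gdom)%O /\ (y < gdom)%O;
  edge_sym : forall x y, edge x y -> edge y x;
  edge_irrefl : forall x, ~ edge x x }.

Definition enumerates_graphs (G : K -> graph) : Prop :=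
  forall H : graph, exists b : K, G b = H.

(* The set G_{<a}; G_{<kappa} is [range G].                                    *)
Definition graphs_below (G : K -> graph) (a : K) : set graph := G @` below a.

(* f a stands for its restriction to a.                                        *)
Definition WCstar (G : K -> graph) : Prop :=
  exists f : K -> K -> graph,
    (forall a b, (b < a)%O -> graphs_below G a (f a b)) /\
    forall (S : set K) (g : K -> graph),
      stationary S -> (forall b, range G (g b)) ->
      stationary [set a : K |
        [/\ reg a,
            (forall b, (b < a)%O -> g b = f a b)
          & stationary_in (below a) (S `&` below a)]].

End Graphs.

(* Main.v *)
(** WC* yields a diamond: a sequence f that guesses every h : kappa -> kappa at
    regular points where a prescribed stationary set reflects. Write a Sigma11
    quasi-order Q on X as the projection of a tree T, and let a chain at a < kappa
    from u to v be a finite sequence of functions a -> a leading from u to v in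
    which consecutive functions are T-related below a through witnesses a -> a.
    Chains, unlike Q itself, compose locally. The reduction sends x to the set of
    all a admitting a chain from f a to x. If Q x y, then at every closure point
    of y and of a witness, chains to x extend to chains to y. If not Q x y, then
    by weak compactness (chains at club many points would converge to a Q-chain
    from x to y) there is no chain from x to y at stationarily many points; where
    f guesses x and this stationary set reflects there is no chain from f a = x
    to y either, since a chain at a restricts to club many b < a. *)
Require Import Defs.
From mathcomp Require Import all_boot all_order.
From mathcomp Require Import boolp classical_sets functions cardinality.
From mathcomp Require Import set_interval filter topology.

Set Implicit Arguments.
Unset Strict Implicit.
Unset Printing Implicit Defensive.

Import Order.TTheory.

Local Open Scope classical_set_scope.
Local Open Scope card_scope.

(** * Least elements and eventual properties *)

Section WellOrder.
Context {d : Order.disp_t} {K : bOrderType d}.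
Implicit Types (a b x y : K) (P : set K).

Lemma ex_least P x : well_founded (fun x y : K => (x < y)%O) -> P x ->
  exists2 m, P m & forall y, P y -> (m <= y)%O.
Proof.
move=> wf; elim/(well_founded_ind wf): x => x IH Px.
case: (pselect (exists2 y, P y & (y < x)%O)) => [[y Py yx]|noy].
  exact: IH yx Py.
exists x => // y Py; rewrite leNgt; apply/negP => yx; apply: noy.
by exists y.
Qed.

(** Excluding [\bot] makes [phi \bot < b] available, so that a constant [phi] forces a lower bound
    on b. *)
Definition closed_under (phi : K -> K) : set K :=
  [set b | b <> \bot%O /\ forall x, (x < b)%O -> (phi x < b)%O].

(** The filter generated by the tails of H. An unbounded H stands below for a measure. *)
Definition evt (H : set K) (P : K -> Prop) : Prop :=
  exists b, forall x, H x -> (b <= x)%O -> P x.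

Lemma evt_impl (H : set K) (P Q : K -> Prop) :
  (forall x, H x -> P x -> Q x) -> evt H P -> evt H Q.
Proof. by move=> PQ [b bP]; exists b => x Hx bx; apply: PQ => //; exact: bP. Qed.

Lemma evt_and (H : set K) (P Q : K -> Prop) :
  evt H P -> evt H Q -> evt H (fun x => P x /\ Q x).
Proof.
move=> [b bP] [c cQ]; exists (Order.max b c) => x Hx.
by rewrite ge_max => /andP[bx cx]; split; [exact: bP|exact: cQ].
Qed.

Lemma evt_ge (H : set K) b : evt H (fun x => (b <= x)%O).
Proof. by exists b. Qed.

Lemma evt_ex (H : set K) (P : K -> Prop) :
  unbounded_in setT H -> evt H P -> exists2 x, H x & P x.
Proof.
by move=> uH [b bP]; have [x Hx bx] := uH b I; exists x => //; exact: bP.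
Qed.

End WellOrder.

(** * Regularity of kappa from the partition property *)

Section Regularity.
Context {d : Order.disp_t} {K : bOrderType d}.
Context (wcK : weakly_compact K).
Implicit Types (a b x y : K).

Lemma wc_wf : well_founded (fun x y : K => (x < y)%O).
Proof. by case: wcK => -[]. Qed.

Lemma wc_below a : ~ ([set: K] #<= below a).
Proof. by case: wcK => -[]. Qed.

Lemma wc_nat : ~ ([set: K] #<= [set: nat]).
Proof. by case: wcK. Qed.

Lemma card_leT_inj T U (B : set U) : [set: T] #<= B ->
  exists f : T -> U, injective f /\ forall t, B (f t).
Proof.
move=> /card_leP[f]; pose g t := f (exist _ t (mem_set I) : [set: T]).
exists (fun t => set_val (g t)); split=> [x y /val_inj|t]; last exact: set_valP.
by move=> /(@inj _ _ _ f _ _ (mem_set I) (mem_set I)) [].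
Qed.

Lemma wc_omega : exists w : nat -> K, injective w.
Proof.
have : [set: nat] #<= [set: K].
  by apply/infiniteP => /finite_set_countable; exact: wc_nat.
by move=> /card_leT_inj[w [winj _]]; exists w.
Qed.

(** If a were the maximum, shifting a sequence [w] below a by one place and sending a to [w 0] would
    inject K into [below a]. *)
Lemma wc_nomax a : exists b, (a < b)%O.
Proof.
apply: contrapT => /forallNP max; apply: (@wc_below a).
have lea x : (x <= a)%O by rewrite leNgt; apply/negP/max.
have : [set: nat] #<= below a.
  apply/infiniteP => fa; apply: wc_nat; apply: finite_set_countable.
  rewrite (_ : [set: K] = below a `|` [set a]) ?finite_setU//.
  apply/seteqP; split=> // x _; have := lea x.
  by rewrite le_eqVlt => /orP[/eqP|]; [right|left].
move=> /card_leT_inj[w [winj wa]].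
have wNa n : w n <> a by move=> e; have := wa n; rewrite /below/= e ltxx.
pose g x := if pselect (exists n, x = w n) is left e then w (projT1 (cid e)).+1
            else if x == a then w 0%N else x.
have gw n : g (w n) = w n.+1.
  rewrite /g; case: pselect => [e|]; last by case; exists n.
  by case: cid => m /= /winj ->.
have gN x : ~ (exists n, x = w n) -> g x = if x == a then w 0%N else x.
  by rewrite /g; case: pselect.
have ginj : injective g.
  move=> x y; case: (pselect (exists n, x = w n)) => [[n ->]|nx];
      case: (pselect (exists n, y = w n)) => [[m ->]|ny].
  - by rewrite !gw => /winj[->].
  - rewrite gw gN//; case: eqP => [_ /winj//|_ e]; by case: ny; exists n.+1.
  - rewrite gw gN//; case: eqP => [_ /winj//|_ e]; by case: nx; exists m.+1.
  - rewrite !gN//; case: eqP => [->|_]; case: eqP => [->|_] // e.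
    + by case: ny; exists 0%N.
    + by case: nx; exists 0%N.
have : g @` [set: K] #= [set: K] by apply: inj_card_eq => x y _ _; exact: ginj.
rewrite card_eq_le => /andP[_ /card_le_trans]; apply; apply: subset_card_le.
move=> _ [x _ <-]; case: (pselect (exists n, x = w n)) => [[n ->]|nx].
  by rewrite gw; exact: wa.
rewrite gN//; case: eqP => [_|/eqP xa]; first exact: wa.
by rewrite /below/= lt_neqAle xa lea.
Qed.

(* Colour a pair by whether its two points are dominated through the same      *)
(* element of A: a homogeneous set lies below a single point f t or injects    *)
(* into A.                                                                     *)
Lemma wc_bound T (A : set T) (f : T -> K) : ~ ([set: K] #<= A) ->
  exists b, forall t, A t -> (f t < b)%O.
Proof.
move=> KA; apply: contrapT => /forallNP unb.
have blkP y : exists t, A t /\ (y <= f t)%O.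
  have /existsNP[t /not_implyP[At /negP]] := unb y.
  by rewrite -leNgt => yt; exists t.
have [blk {}blkP] := choice blkP.
have [_ _ /(_ (fun x y => `[< blk x = blk y >]))[H [i [HK Hi]]]] := wcK.
have KH : [set: K] #<= H by move: HK; rewrite card_eq_le => /andP[].
case: i Hi => Hi.
  have [x0 Hx0] : H !=set0.
    apply/set0P/eqP => H0; move: KH; rewrite H0 card_le0 => /eqP/seteqP[h _].
    exact: (h \bot%O).
  have same x : H x -> blk x = blk x0.
    move=> Hx; case: (ltgtP x x0) => [xx0|x0x|->//].
    - by have /asboolP := Hi _ _ Hx Hx0 xx0.
    - by have /asboolP := Hi _ _ Hx0 Hx x0x.
  have [b b0] := wc_nomax (f (blk x0)).
  apply: (@wc_below b); apply: card_le_trans KH _; apply: subset_card_le => x Hx.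
  by apply: le_lt_trans b0; rewrite -(same x Hx); exact: (blkP x).2.
apply: KA; apply: card_le_trans KH _.
have inj : {in H &, injective blk}.
  move=> x y /set_mem Hx /set_mem Hy e; case: (ltgtP x y) => // xy.
  - by have /asboolP := Hi _ _ Hx Hy xy.
  - by have /asboolP := Hi _ _ Hy Hx xy; rewrite e.
have := inj_card_eq inj; rewrite card_eq_le => /andP[_ /card_le_trans]; apply.
apply: subset_card_le => _ [x _ <-]; exact: (blkP x).1.
Qed.

Lemma wc_bound_below a (f : K -> K) : exists b, forall x, (x < a)%O -> (f x < b)%O.
Proof. by have [b bP] := wc_bound f (@wc_below a); exists b. Qed.

Lemma wc_bound_nat (f : nat -> K) : exists b, forall n, (f n < b)%O.
Proof. by have [b bP] := wc_bound f wc_nat; exists b => n; exact: bP. Qed.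

(** This is kappa-completeness of the tail filter: fewer than kappa starting points have a common
    bound. *)
Lemma evt_all T (A : set T) (H : set K) (P : T -> K -> Prop) :
  ~ ([set: K] #<= A) -> (forall t, A t -> evt H (P t)) ->
  evt H (fun x => forall t, A t -> P t x).
Proof.
move=> KA HP.
have bP t : exists b, A t -> forall x, H x -> (b <= x)%O -> P t x.
  by case: (pselect (A t)) => [/HP[b bP]|]; [exists b|exists \bot%O].
have [f {}bP] := choice bP; have [b fb] := wc_bound f KA.
exists b => x Hx bx t At; apply: bP => //; apply: le_trans bx; exact/ltW/fb.
Qed.

Lemma evt_below (H : set K) a (P : K -> K -> Prop) :
  (forall y, (y < a)%O -> evt H (P y)) ->
  evt H (fun x => forall y, (y < a)%O -> P y x).
Proof. exact: evt_all (@wc_below a). Qed.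

Lemma evt_nat (H : set K) (P : nat -> K -> Prop) :
  (forall n, evt H (P n)) -> evt H (fun x => forall n, P n x).
Proof.
move=> HP; have := @evt_all _ _ _ P wc_nat (fun n _ => HP n).
by apply: evt_impl => x _ Px n; exact: Px.
Qed.

End Regularity.

(** * Complete and normal measures on small families *)

Section Normal.
Context {d : Order.disp_t} {K : bOrderType d}.
Context (wcK : weakly_compact K).
Implicit Types (a b x y : K) (H : set K).

Lemma large_unbounded H : [set: K] #<= H -> unbounded_in setT H.
Proof.
move=> KH b _; apply: contrapT => noH; apply: (@wc_below _ _ wcK b).
apply: card_le_trans KH _; apply: subset_card_le => x Hx.
by rewrite /below/= ltNge; apply/negP => bx; apply: noH; exists x.
Qed.

Definition small (I : Type) : Prop := exists e : K -> I, forall i, exists k, e k = i.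

(* Colour x < y by whether the characteristic sequences of x and y increase    *)
(* lexicographically; along a homogeneous set each digit is eventually         *)
(* constant, by induction on its position.                                     *)
Lemma wc_measure I (A : I -> K -> Prop) : small I ->
  exists2 H, unbounded_in setT H & forall i, evt H (A i) \/ evt H (fun x => ~ A i x).
Proof.
move=> [e eP]; pose chi x k := `[< A (e k) x >].
pose lexlt x y := exists k, [/\ (forall j, (j < k)%O -> chi x j = chi y j),
  chi x k = false & chi y k = true].
have [_ _ /(_ (fun x y => `[< lexlt x y >]))[H [i [HK Hi]]]] := wcK.
have uH : unbounded_in setT H.
  by apply: large_unbounded; move: HK; rewrite card_eq_le => /andP[].
have stab k : exists v, evt H (fun x => chi x k = v).
  elim/(well_founded_ind (wc_wf wcK)): k => k IH.
  have [b bP] : evt H (fun x => forall y, H y -> (x < y)%O ->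
      forall j, (j < k)%O -> chi x j = chi y j).
    have [b bP] : evt H (fun x => forall j, (j < k)%O ->
        forall y, H y -> (x < y)%O -> chi x j = chi y j).
      apply: (evt_below wcK) => j /IH[v [b bP]]; exists b => x Hx bx y Hy xy.
      by rewrite !bP//; exact: le_trans bx (ltW xy).
    by exists b => x Hx bx y Hy xy j jk; apply: (bP x Hx bx).
  (* Past b the points of H agree on all digits before k, so homogeneity lets digit k change in one
     direction only: once equal to i it stays i. *)
  have mono x y : H x -> (b <= x)%O -> H y -> (x < y)%O -> chi x k = i -> chi y k = i.
    move=> Hx bx Hy xy; have := Hi x y Hx Hy xy; have agr := bP x Hx bx y Hy xy.
    case: i {Hi} => [/asboolP[l [ll xl yl]]|/asboolPn nlex] xk; last first.
      by apply/negP => yk; apply: nlex; exists k.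
    case: (ltgtP l k) => [lk|kl|<-//]; last by rewrite -ll.
    by have := agr l lk; rewrite xl yl.
  case: (pselect (exists x, [/\ H x, (b <= x)%O & chi x k = i])).
    move=> [x [Hx bx xk]]; exists i, x => y Hy; rewrite le_eqVlt => /orP[/eqP<-//|xy].
    exact: mono xk.
  move=> nox; exists (~~ i), b => x Hx bx.
  have : chi x k <> i by move=> xi; apply: nox; exists x.
  by case: (chi x k); case: (i).
exists H => // j; have [k <-] := eP j; have [[] vP] := stab k; [left|right].
- by apply: evt_impl vP => x _ /asboolP.
- by apply: evt_impl vP => x _ /asboolPn.
Qed.

(* A normal ultrafilter on the algebra generated by D: among the functions     *)
(* obtained from the identity by composing with the D ^~ j, take a minimal     *)
(* unbounded one modulo the measure H; the wanted set is the image of H by it. *)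
Lemma wc_normal J (D : K -> J -> K) : small J -> small (seq J * (K + J)) ->
  exists2 H, unbounded_in setT H &
    forall j, (exists v, evt H (fun x => D x j = v)) \/ evt H (fun x => (x <= D x j)%O).
Proof.
move=> sJ sI; pose gen (w : seq J) x := foldr (fun j y => D y j) x w.
(* The measure has to decide the fibres of every composite and the places where [D] takes it to a
   smaller value. *)
pose A (i : seq J * (K + J)) x := match i.2 with
  | inl v => gen i.1 x = v
  | inr j => (D (gen i.1 x) j < gen i.1 x)%O
  end.
have [H uH HA] := wc_measure A sI.
pose unb w := forall v, evt H (fun x => gen w x <> v).
have [w uw wmin] : exists2 w, unb w & forall j, unb (j :: w) ->
    evt H (fun x => (gen w x <= D (gen w x) j)%O).
  apply: contrapT => nomin.
  (* Without a minimal composite there is an infinite sequence of them, each eventually below the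
     last; by countable completeness all these inequalities hold at one x, an infinite descent. *)
  have step (w : {w | unb w}) : exists w' : {w | unb w},
      evt H (fun x => (gen (sval w') x < gen (sval w) x)%O).
    case: w => w uw /=; apply: contrapT => nw; apply: nomin; exists w => // j ujw.
    have [jw|] := HA (w, inr j); last first.
      by apply: evt_impl => x _ /negP; rewrite -leNgt.
    by case: nw; exists (exist _ (j :: w) ujw).
  have [nx nxP] := choice step.
  have unil : unb [::].
    move=> v; have [b vb] := wc_nomax wcK v; exists b => x _ bx /= xv.
    by move: bx; rewrite xv leNgt vb.
  pose W n := iter n nx (exist _ [::] unil).
  have [x Hx xP] := evt_ex uH (evt_nat wcK (fun n => nxP (W n))).
  have [m [n _ mE] mmin] := @ex_least _ _ (range (fun n => gen (sval (W n)) x)) _ (wc_wf wcK)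
    (imageT (fun n => gen (sval (W n)) x) 0%N).
  by have := mmin _ (imageT (fun n => gen (sval (W n)) x) n.+1); rewrite -mE leNgt (xP n).
have wge v : evt H (fun x => (v <= gen w x)%O).
  have := evt_below wcK (fun y (_ : (y < v)%O) => uw y).
  by apply: evt_impl => x _ xv; rewrite leNgt; apply/negP => /xv.
(* [gen w] is bounded on initial segments, so large values come only from large arguments. *)
have push P : evt H (fun x => P (gen w x)) -> evt (gen w @` H) P.
  move=> [b bP]; have [c cP] := wc_bound_below wcK b (gen w).
  exists c => _ [x Hx <-] cx; apply: bP => //; rewrite leNgt; apply/negP => xb.
  by have := cP x xb; rewrite ltNge cx.
exists (gen w @` H) => [b _|j].
  by have [x Hx bx] := evt_ex uH (wge b); exists (gen w x) => //; exists x.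
case: (pselect (unb (j :: w))) => [ujw|/existsNP[v nv]].
  by right; apply: push; exact: wmin.
left; exists v; apply: push; by case: (HA (j :: w, inl v)).
Qed.

End Normal.

Arguments small {d} K I.

(** * Closure points, clubs and inclusion modulo nonstationary sets *)

Section Stationary.
Context {d : Order.disp_t} {K : bOrderType d}.
Context (wcK : weakly_compact K).
Implicit Types (a b x y : K) (A S : set K) (phi : K -> K).

(** What the construction of clubs requires of A. It holds for kappa and for uncountable regular
    cardinals below it, so one argument serves both. *)
Definition regular_segment A : Prop :=
  [/\ forall a b, A b -> (a < b)%O -> A a,
      forall a f, A a -> (forall x, (x < a)%O -> A (f x)) ->
        exists2 b, A b & forall x, (x < a)%O -> (f x < b)%O
    & forall s : nat -> K, (forall n, A (s n)) -> exists2 b, A b & forall n, (s n < b)%O].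

(** For unboundedness, iterate a function that dominates [phi] on initial segments; the supremum of
    the first omega iterates is a closure point. *)
Lemma club_closed_under A phi : regular_segment A ->
  (forall x, A x -> A (phi x)) -> club_in A (A `&` closed_under phi).
Proof.
move=> [Adown Areg Aomega] Aphi; split; first by move=> x [].
- move=> x0 Ax0.
  have nxP x : exists y, A x -> [/\ A y, (x < y)%O & forall c, (c < x)%O -> (phi c < y)%O].
    case: (pselect (A x)) => Ax; last by exists x.
    have [b Ab bP] := Areg x phi Ax (fun c cx => Aphi c (Adown _ _ Ax cx)).
    (* A constant sequence turns the countable clause into a point of A above both x and b. *)
    have [c Ac cP] := Aomega (fun=> Order.max x b) (fun=> ltac:(by case: (leP x b))).
    exists c => _; have := cP 0%N; rewrite gt_max => /andP[xc bc].
    by split=> // z /bP zb; exact: lt_trans bc.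
  have [nx {}nxP] := choice nxP.
  pose s n := iter n nx x0.
  have As n : A (s n) by elim: n => //= n IH; have [] := nxP _ IH.
  have [b Ab bP] := Aomega s As.
  have [l lP lmin] := @ex_least _ _ [set b | forall n, (s n < b)%O] b (wc_wf wcK) bP.
  exists l; last exact/ltW/(lP 0%N).
  split.
    by have := lmin b bP; rewrite le_eqVlt => /orP[/eqP->//|]; exact: Adown.
  split=> [l0|c cl]; first by have := lP 0%N; rewrite l0 ltx0.
  have [n cn] : exists n, (c <= s n)%O.
    apply: contrapT => /forallNP nc; have := lmin c; rewrite leNgt cl.
    by apply: contraPP => _ h; suff : false by []; apply: h => n; rewrite ltNge; apply/negP.
  (* Two more iterates are used: [c <= s n < s n.+1] gives [phi c < s n.+2]. *)
  have [_ lt1 _] := nxP _ (As n); have [_ _ h] := nxP _ (As n.+1).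
  by apply: lt_trans (lP n.+2); apply: h; exact: le_lt_trans lt1.
- move=> l Al [l0 ll]; split=> //; split=> // b bl.
  have [y [_ [_ yP]] /andP[by_ yl]] := ll b bl.
  by apply: lt_trans yl; exact: yP.
Qed.

Lemma regular_segmentT : regular_segment [set: K].
Proof.
split=> // [a f _ _|s _].
- by have [b bP] := wc_bound_below wcK a f; exists b.
- by have [b bP] := wc_bound_nat wcK s; exists b.
Qed.

(* reg also contains omega, which the bound b on a copy of omega excludes.     *)
Lemma regular_segment_reg (w : nat -> K) a b : injective w ->
  (forall n, (w n < b)%O) -> (b < a)%O -> reg a -> regular_segment (below a).
Proof.
move=> winj wb ba [_ acard areg].
have bnd (C : set K) : C `<=` below a -> ~ (below a #<= C) ->
    exists2 b, below a b & forall x, C x -> (x < b)%O.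
  move=> Ca aC; apply: contrapT => nb; apply: aC; apply: areg => // x xa.
  apply: contrapT => nx; apply: nb; exists x => // y Cy; rewrite ltNge.
  by apply/negP => xy; apply: nx; exists y.
have wlarge : [set: nat] #<= below b.
  have := @inj_card_eq _ _ [set: nat] w (in2W winj); rewrite card_eq_le.
  move=> /andP[_ /card_le_trans]; apply; apply: subset_card_le => _ [n _ <-].
  exact: wb.
split=> [x y /= ya xy|c f ca fa|s sa]; first exact: lt_trans ya.
- have [||e ea eP] := bnd (f @` below c); first by move=> _ [x xc <-]; exact: fa.
    by move=> h; apply: (acard c) => //; apply: card_le_trans h _; exact: card_image_le.
  by exists e => // x xc; apply: eP; exists x.
- have [||e ea eP] := bnd (range s); first by move=> _ [n _ <-].
    move=> h; apply: (acard b) => //; apply: card_le_trans h _.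
    by apply: card_le_trans wlarge; exact: card_image_le.
  by exists e => // n; apply: eP; exists n.
Qed.

(** Closure points form a club; conversely, a closure point of the next-element function of a club
    is a limit point of that club. *)
Lemma stationaryP S : stationary S <-> forall phi, exists2 b, S b & closed_under phi b.
Proof.
split=> [sS phi|sS C [_ uC clC]].
  have [|x [Sx [_ xphi]]] := sS _ (club_closed_under (phi := phi) regular_segmentT _) => //.
  by exists x.
have nxP b : exists c, C c /\ (b < c)%O.
  have [b' bb'] := wc_nomax wcK b; have [c Cc b'c] := uC b' I.
  by exists c; split=> //; exact: lt_le_trans b'c.
have [phi phiP] := choice nxP; have [b Sb [b0 bphi]] := sS phi.
exists b; split=> //; apply: clC => //; split=> // x xb; exists (phi x).
  exact: (phiP x).1.
by rewrite (phiP x).2 bphi.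
Qed.

Lemma stationaryPn S : ~ stationary S <->
  exists phi, forall b, closed_under phi b -> ~ S b.
Proof.
rewrite stationaryP -existsNE; split=> -[phi phiP]; exists phi.
  by move=> b bphi Sb; apply: phiP; exists b.
by move=> [b Sb bphi]; exact: phiP bphi Sb.
Qed.

Lemma stationary_sub S S' : S `<=` S' -> stationary S -> stationary S'.
Proof. by move=> SS' sS C /sS[x [/SS' S'x Cx]]; exists x. Qed.

Lemma closed_under_max phi psi b : closed_under (fun x => Order.max (phi x) (psi x)) b ->
  closed_under phi b /\ closed_under psi b.
Proof.
move=> [b0 bP]; split; split=> // x /bP; rewrite gt_max => /andP[] //.
Qed.

Lemma stationaryT : stationary [set: K].
Proof. by move=> C [_ uC _]; have [y Cy _] := uC \bot%O I; exists y. Qed.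

(** One relation for both quasi-orders: P is [reg] for [sub_reg] and [setT] for [sub_NS]. *)
Definition sub_mod (P : set K) (eta xi : baire K) : Prop :=
  ~ stationary ((ones eta `\` ones xi) `&` P).

Lemma sub_mod_quasi_order (X : set (baire K)) P : quasi_order X (sub_mod P).
Proof.
split=> [x _|x y z _ _ _ /stationaryPn[phi phiP] /stationaryPn[psi psiP]].
  by apply/stationaryPn; exists id => b _ [[]].
apply/stationaryPn; exists (fun b => Order.max (phi b) (psi b)).
move=> b /closed_under_max[bphi bpsi] [[bx bz] Pb].
apply: (phiP b bphi); split=> //; split=> // b_y.
by apply: (psiP b bpsi); split.
Qed.

End Stationary.

(** * The guessing sequence and sets of size at most kappa *)

Section Guessing.
Context {d : Order.disp_t} {K : bOrderType d}.
Context (wcK : weakly_compact K).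
Implicit Types (a b x y : K) (S : set K).

Definition guessing (f : K -> K -> K) : Prop :=
  forall S h, stationary S -> stationary [set a |
    [/\ reg a, forall b, (b < a)%O -> h b = f a b
      & stationary_in (below a) (S `&` below a)]].

(* The ordinal a is coded by the edgeless graph with vertex set a.             *)
Lemma WCstar_guessing (G : K -> graph K) : enumerates_graphs G -> WCstar G ->
  exists f, guessing f.
Proof.
move=> enumG [f [_ fP]]; exists (fun a b => gdom (f a b)) => S h sS.
pose E a : graph K := @Graph d K a (fun _ _ => False) (fun _ _ => False_ind _)
  (fun _ _ => id) (fun _ => id).
have Erange b : range G (E (h b)) by have [c cE] := enumG (E (h b)); exists c.
apply: stationary_sub (fP S (fun b => E (h b)) sS Erange) => a [ra ga sa].
by split=> // b ba; rewrite -(ga b ba).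
Qed.

Context (f : K -> K -> K) (fP : guessing f).

(** Guessing p at a point above a shows that kappa^{<kappa} has size at most kappa. *)
Lemma guess_node (p : K -> K) a : exists c, forall b, (b < a)%O -> f c b = p b.
Proof.
have /(stationaryP wcK)/(_ (fun=> a))[c [_ cp _] [c0 ca]] := fP p stationaryT.
exists c => b ba; rewrite cp//; apply: lt_trans ba (ca \bot%O _).
by rewrite lt0x; apply/eqP.
Qed.

(** A pair is read off a guessed function at the two positions [\bot] and [o]. *)
Lemma small_pairK : small K (K * K).
Proof.
have [o o0] := wc_nomax wcK \bot%O; have [a oa] := wc_nomax wcK o.
exists (fun c => (f c \bot%O, f c o)) => -[x y].
have [c cP] := guess_node (fun b => if b == \bot%O then x else y) a.
exists c; rewrite !cP ?eqxx ?(gt_eqF o0)//; exact: lt_trans oa.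
Qed.

Lemma small_surj I J (e : I -> J) : small K I -> (forall j, exists i, e i = j) ->
  small K J.
Proof.
move=> [g gP] eP; exists (e \o g) => j; have [i <-] := eP j; have [k <-] := gP i.
by exists k.
Qed.

Lemma small_K : small K K.
Proof. by exists id => k; exists k. Qed.

Lemma small_prod I J : small K I -> small K J -> small K (I * J).
Proof.
move=> [g gP] [h hP]; apply: (@small_surj _ _ (fun k => (g k.1, h k.2))) small_pairK _.
by move=> [i j]; have [k <-] := gP i; have [l <-] := hP j; exists (k, l).
Qed.

Lemma small_unit : small K unit.
Proof. by exists (fun=> tt) => -[]; exists \bot%O. Qed.

Lemma small_sum I J : small K I -> small K J -> small K (I + J).
Proof.
move=> [g gP] [h hP]; have [o o0] := wc_nomax wcK \bot%O.
apply: (@small_surj _ _ (fun k => if k.1 == \bot%O then inl (g k.2) else inr (h k.2)))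
  small_pairK _.
move=> [i|j]; [have [k <-] := gP i|have [k <-] := hP j].
- by exists (\bot%O, k); rewrite eqxx.
- by exists (o, k); rewrite /= gt_eqF.
Qed.

Lemma small_nat : small K nat.
Proof.
have [w winj] := wc_omega wcK.
exists (fun k => if pselect (exists n, w n = k) is left e then projT1 (cid e) else 0%N).
move=> n; exists (w n); case: pselect => [e|]; last by case; exists n.
by case: cid => m /= /winj.
Qed.

Lemma small_seq I : small K I -> small K (seq I).
Proof.
move=> sI; have gP n : exists g : K -> seq I, forall s, size s = n -> exists k, g k = s.
  elim: n => [|n [g gP]].
    by exists (fun=> [::]) => s /size0nil ->; exists \bot%O.
  have [e eP] := small_prod sI small_K.
  exists (fun k => (e k).1 :: g (e k).2) => -[//|i s] [/gP[k <-]].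
  by have [l el] := eP (i, k); exists l; rewrite el.
have [g {}gP] := choice gP.
apply: (@small_surj _ _ (fun k => g k.1 k.2)) (small_prod small_nat small_K) _ => s.
by have [k kP] := gP _ s erefl; exists (size s, k).
Qed.

End Guessing.

(** * Borel sets and Sigma11 relations as projections of trees *)

Section Borel.
Context {d : Order.disp_t} {K : bOrderType d}.
Context (wcK : weakly_compact K).
Context (f : K -> K -> K) (fP : guessing f).
Implicit Types (a b : K) (x y z : K -> K) (X U : set (baire K)).

Lemma open_cylinder U (x : baire K) : open U -> U x -> exists a, cylinder x a `<=` U.
Proof.
move=> [D sD <-] [V DV Vx]; have [p [a Va]] := sD V DV; exists a => y xy.
exists V => //; move: Vx; rewrite Va => px b ba.
by rewrite xy// px.
Qed.

Lemma nbhs_cylinder (x : baire K) U : nbhs x U -> exists a, cylinder x a `<=` U.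
Proof.
rewrite nbhsE => -[V [oV Vx] VU]; have [a aV] := open_cylinder oV Vx.
by exists a; exact: subset_trans VU.
Qed.

(** Unions in [borel] run over all of K and cannot be empty, so disjoint cylinders are intersected
    instead. *)
Lemma borel_set0 : borel (@set0 (baire K)).
Proof.
have [o o0] := wc_nomax wcK \bot%O.
rewrite (_ : set0 = \bigcap_(i : K) cylinder (fun=> i) o).
  by apply: borel_bigcap => i; apply: borel_basic; exists (fun=> i), o.
apply/seteqP; split=> // x xP; have := xP \bot%O I \bot%O o0; rewrite (xP o I \bot%O o0).
by move=> oE; move: o0; rewrite oE ltxx.
Qed.

Lemma borel_setI X U : borel X -> borel U -> borel (X `&` U).
Proof.
move=> bX bU; have [o o0] := wc_nomax wcK \bot%O.
rewrite (_ : X `&` U = \bigcap_(i : K) if i == \bot%O then X else U).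
  by apply: borel_bigcap => i; case: ifP.
apply/seteqP; split=> [x [Xx Ux] i _|x xP]; first by case: ifP.
by split; [have := xP \bot%O I|have := xP o I]; rewrite ?eqxx ?(gt_eqF o0).
Qed.

(* By guess_node there are only kappa many basic open sets.                    *)
Lemma borel_cylinders U : (forall x, U x -> exists a, cylinder x a `<=` U) -> borel U.
Proof.
move=> oU; rewrite (_ : U = \bigcup_(c : K) \bigcup_(a : K)
    if `[< cylinder (f c) a `<=` U >] then cylinder (f c) a else set0).
  apply: borel_bigcup => c; apply: borel_bigcup => a; case: ifP => _.
    by apply: borel_basic; exists (f c), a.
  exact: borel_set0.
apply/seteqP; split=> [x Ux|x [c _ [a _]]]; last first.
  by case: ifP => // /asboolP; apply.
have [a aU] := oU x Ux; have [c cP] := guess_node wcK fP x a.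
exists c => //; exists a => //; rewrite ifT; first by move=> b ba; rewrite cP.
by apply/asboolP => y cy; apply: aU => b ba; rewrite cy// cP.
Qed.

Definition agree a x y : Prop := forall b, (b < a)%O -> x b = y b.

Lemma agree_le a b x y : (b <= a)%O -> agree a x y -> agree b x y.
Proof. by move=> ba xy c cb; apply: xy; exact: lt_le_trans ba. Qed.

Lemma agree_sym a x y : agree a x y -> agree a y x.
Proof. by move=> xy b ba; rewrite xy. Qed.

Lemma agree_comp a (g : K -> K) x y : agree a x y -> agree a (g \o x) (g \o y).
Proof. by move=> xy b ba /=; rewrite xy. Qed.

Definition tree_set X : Prop := exists T : K -> (K -> K) -> (K -> K) -> Prop,
  (forall a x x' z z', agree a x x' -> agree a z z' -> T a x z -> T a x' z') /\
  forall x, X x <-> exists z, forall a, T a x z.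

Lemma pairing : exists (p : K -> K -> K) (q : K -> K * K), forall a b, q (p a b) = (a, b).
Proof.
have [q qP] := small_pairK wcK fP.
have [p pP] := choice qP.
by exists (fun a b => p (a, b)), q => a b; rewrite pP.
Qed.

(** A witness for a union carries the chosen index beside each value; a witness for an intersection
    interleaves witnesses for all indices along the pairing. *)
Lemma borel_tree_set X : borel X -> tree_set X.
Proof.
have [p [q pq]] := pairing.
elim=> {X} [U [t [a ->]]|F _ FT|F _ FT].
- exists (fun b x _ => forall c, (c < a)%O -> (c < b)%O -> x c = t c).
  split=> [b x x' z z' xx' _ xP c ca cb|x]; first by rewrite -xx'// xP.
  split=> [xP|[z zP] b ba]; first by exists (fun=> \bot%O) => b c ca _; exact: xP.
  by have [b' bb'] := wc_nomax wcK b; exact: (zP b').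
- have [T {}FT] := choice FT.
  (* The index is read at [\bot], which must lie below a for locality; ranging over [b <= a]
     recovers the test at level [\bot]. *)
  exists (fun a x z => forall b, (b <= a)%O -> (\bot < a)%O ->
    T (q (z \bot%O)).1 b x (fun c => (q (z c)).2)).
  split=> [a x x' z z' xx' zz' xP b ba a0|x].
    rewrite -zz'//; apply: (FT _).1 (xP b ba a0); first exact: agree_le xx'.
    by move=> c cb; rewrite zz'//; exact: lt_le_trans ba.
  split=> [[i _ /(FT i).2[z zP]]|[z zP]].
    exists (fun c => p i (z c)) => a b _ _; rewrite pq.
    by rewrite (_ : (fun c => _) = z)//; apply/funext => c; rewrite pq.
  exists (q (z \bot%O)).1 => //; apply/(FT _).2; eexists => b.
  have [b' bb'] := wc_nomax wcK b; apply: (zP b'); first exact: ltW.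
  exact: le_lt_trans bb'.
- have [T {}FT] := choice FT.
  (* Level b of the i-th witness is tested only once all its codes [p i c] lie below a. *)
  exists (fun a x z => forall i b, (b <= a)%O -> (forall c, (c < b)%O -> (p i c < a)%O) ->
    T i b x (fun c => z (p i c))).
  split=> [a x x' z z' xx' zz' xP i b ba pa|x].
    apply: (FT _).1 (xP i b ba pa); first exact: agree_le xx'.
    by move=> c cb; rewrite zz'//; exact: pa.
  split=> [xP|[z zP] i _].
    have /choice[z zP] : forall i, exists z, forall a, T i a x z.
      by move=> i; apply/(FT i).2; exact: xP.
    exists (fun c => z (q c).1 (q c).2) => a i b _ _.
    by rewrite (_ : (fun c => _) = z i)//; apply/funext => c; rewrite pq.
  apply/(FT i).2; exists (fun c => z (p i c)) => b.
  have [a aP] := wc_bound_below wcK b (p i).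
  apply: (zP (Order.max a b)); first by rewrite le_max lexx orbT.
  by move=> c cb; rewrite lt_max aP.
Qed.

Definition tree_rel (R : (K -> K) -> (K -> K) -> Prop)
    (T : K -> (K -> K) -> (K -> K) -> (K -> K) -> Prop) : Prop :=
  (forall a x x' y y' z z', agree a x x' -> agree a y y' -> agree a z z' ->
     T a x y z -> T a x' y' z') /\
  forall x y, R x y <-> exists z, forall a, T a x y z.

Lemma closed_tree (C : set (baire K * baire K * baire K)) x y z : closed C ->
  (forall a, exists x' y' z',
    [/\ C (x', y', z'), agree a x' x, agree a y' y & agree a z' z]) -> C (x, y, z).
Proof.
move=> cC xyz; apply: cC => A [[P Q] /= [[[P1 P2] /= [nP1 nP2] sP] nQ] sA].
have [a1 h1] := nbhs_cylinder nP1; have [a2 h2] := nbhs_cylinder nP2.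
have [a3 h3] := nbhs_cylinder nQ.
have [x' [y' [z' [Cxyz xx yy zz]]]] := xyz (Order.max a1 (Order.max a2 a3)).
exists (x', y', z'); split=> //; apply: sA; split=> /=.
- apply: sP; split=> /=; [apply: h1|apply: h2] => b ba.
  + by rewrite xx// lt_max ba.
  + by rewrite yy// !lt_max ba orbT.
- by apply: h3 => b ba; rewrite zz// !lt_max ba !orbT.
Qed.

(** Membership in X is built into the relation, so that intermediate points of a chain stay where Q
    is transitive. The witness packs three: one for each membership and one for C. *)
Lemma Sigma11_tree X (Q : baire K -> baire K -> Prop) : borel X -> Sigma11 X Q ->
  exists T, tree_rel (fun x y => [/\ X x, X y & Q x y]) T.
Proof.
move=> /borel_tree_set[TX [TXl TXP]] [C cC CQ].
have [q qP] := small_prod wcK fP (small_pairK wcK fP) (small_K (K := K)).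
have [p pq] := choice qP.
pose q1 c := (q c).1.1; pose q2 c := (q c).1.2; pose q3 c := (q c).2.
exists (fun a x y z => [/\ TX a x (q1 \o z), TX a y (q2 \o z) & exists x' y' z',
  [/\ C (x', y', z'), agree a x' x, agree a y' y & agree a z' (q3 \o z)]]).
split=> [a x x1 y y1 z z1 xx yy zz [xP yP [x' [y' [z' [Cxyz xx' yy' zz']]]]]|x y].
  split; [apply: TXl xP|apply: TXl yP|] => //; try exact: agree_comp.
  exists x', y', z'; split=> // b ba.
  - by rewrite xx'//; exact: xx.
  - by rewrite yy'//; exact: yy.
  - by rewrite zz'//=; rewrite zz.
split=> [[Xx Xy Qxy]|[z zP]].
  have [z1 z1P] := (TXP x).1 Xx; have [z2 z2P] := (TXP y).1 Xy.
  have [z3 z3P] := (CQ x y Xx Xy).1 Qxy.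
  pose z c := p (z1 c, z2 c, z3 c).
  have e1 : q1 \o z = z1 by apply/funext => c; rewrite /q1/= /z pq.
  have e2 : q2 \o z = z2 by apply/funext => c; rewrite /q2/= /z pq.
  have e3 : q3 \o z = z3 by apply/funext => c; rewrite /q3/= /z pq.
  by exists z => a; rewrite e1 e2 e3; split=> //; exists x, y, z3; split.
have Xx : X x by apply/TXP; exists (q1 \o z) => a; have [] := zP a.
have Xy : X y by apply/TXP; exists (q2 \o z) => a; have [] := zP a.
split=> //; apply/CQ => //; exists (q3 \o z); apply: closed_tree => // a.
by have [] := zP a.
Qed.

End Borel.

(** * Chains and the reduction built from them *)

Section Chains.
Context {d : Order.disp_t} {K : bOrderType d}.
Context (wcK : weakly_compact K).
Context (f : K -> K -> K) (fP : guessing f).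
Context (R : (K -> K) -> (K -> K) -> Prop).
Context (T : K -> (K -> K) -> (K -> K) -> (K -> K) -> Prop) (RT : tree_rel R T).
Implicit Types (a b c : K) (u v x y z : K -> K).

Definition chain a u v : Prop := exists n (W Z : nat -> K -> K),
  [/\ forall i b, (b < a)%O -> (W i b < a)%O /\ (Z i b < a)%O,
      agree a u (W 0%N), agree a (W n) v
    & forall i, (i < n)%N -> forall c, (c < a)%O -> T c (W i) (W i.+1) (Z i)].

Lemma chain_refl a u : closed_under u a -> chain a u u.
Proof. by move=> [_ ua]; exists 0%N, (fun=> u), (fun=> u); split=> // i b /ua. Qed.

Lemma chain_agree a u u' v v' : agree a u u' -> agree a v v' ->
  chain a u v -> chain a u' v'.
Proof.
move=> uu vv [n [W [Z [WZ uW Wv WT]]]]; exists n, W, Z; split=> // b ba.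
- by rewrite -uu// uW.
- by rewrite Wv// vv.
Qed.

(** The last function of the chain agrees with x below a, and T at levels below a cannot tell them
    apart, so y can be appended. *)
Lemma chain_step a u x y z : (forall c, T c x y z) -> closed_under y a ->
  closed_under z a -> chain a u x -> chain a u y.
Proof.
move=> xyz [_ ya] [_ za] [n [W [Z [WZ uW Wx WT]]]].
exists n.+1, (fun i => if (i <= n)%N then W i else y), (fun i => if (i < n)%N then Z i else z).
split=> [i b ba||b ba|i].
- by split; case: ifP => _; [exact: (WZ i b ba).1|exact: ya|exact: (WZ i b ba).2|exact: za].
- by rewrite leq0n.
- by rewrite ltnn.
- rewrite ltnS; case: ltngtP => // [lt_in|->] _ c ca; first exact: WT.
  apply: RT.1 (xyz c) => // b bc.
  by rewrite Wx//; exact: lt_trans ca.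
Qed.

(** Let [phi b] bound the countably many values at b; at closure points of [phi] the same functions
    still form a chain. *)
Lemma chain_restrict a u v : regular_segment (below a) -> chain a u v ->
  exists2 phi, (forall b, (b < a)%O -> (phi b < a)%O) &
    forall b, (b < a)%O -> closed_under phi b -> chain b u v.
Proof.
move=> [_ _ reg_a] [n [W [Z [WZ uW Wv WT]]]].
have /choice[phi phiP] b : exists c, (b < a)%O ->
    (c < a)%O /\ forall i, (W i b < c)%O /\ (Z i b < c)%O.
  case: (boolP (b < a)%O) => [ba|_]; last by exists b.
  have [i|c ca cP] := reg_a (fun i => Order.max (W i b) (Z i b)).
    by rewrite /below/= gt_max (WZ i b ba).1 (WZ i b ba).2.
  by exists c => _; split=> // i; have := cP i; rewrite gt_max => /andP[].
exists phi => [b /phiP[]//|b ba [_ bphi]]; exists n, W, Z; split.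
- move=> i c cb; have [_ /(_ i)[Wc Zc]] := phiP c (lt_trans cb ba).
  by split; [apply: lt_trans Wc _|apply: lt_trans Zc _]; exact: bphi.
- by apply: agree_le uW; exact: ltW.
- by apply: agree_le Wv; exact: ltW.
- by move=> i lt_in c cb; apply: WT => //; exact: lt_trans ba.
Qed.

(* The reflection argument: the chains at the closure points of phi converge   *)
(* along the normal filter of wc_normal to an R-chain from x to y.             *)
Lemma chain_limit phi b0 x y :
  (forall a, closed_under phi a -> (b0 < a)%O -> chain a x y) ->
  exists n (W : nat -> K -> K), [/\ W 0%N = x, W n = y &
    forall i, (i < n)%N -> R (W i) (W i.+1)].
Proof.
move=> chainP; have [w winj] := wc_omega wcK; have [b1 wb1] := wc_bound_nat wcK w.
pose spec a (N : nat) (W Z : nat -> K -> K) :=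
  [/\ forall i b, (b < a)%O -> (W i b < a)%O /\ (Z i b < a)%O,
      agree a x (W 0%N), agree a (W N) y
    & forall i, (i < N)%N -> forall c, (c < a)%O -> T c (W i) (W i.+1) (Z i)].
have /choice[data dataP] a : exists t : nat * (nat -> K -> K) * (nat -> K -> K),
    closed_under phi a -> (b0 < a)%O -> spec a t.1.1 t.1.2 t.2.
  case: (pselect (closed_under phi a /\ (b0 < a)%O)) => [[ca ba]|nca].
    by have [n [W [Z nWZ]]] := chainP a ca ba; exists (n, W, Z).
  by exists (0%N, fun=> id, fun=> id) => ca ba; case: nca.
pose N a := (data a).1.1; pose W a := (data a).1.2; pose Z a := (data a).2.
(* A failure of closure at a would make [bad] regressive, hence eventually a constant v; but then
   [a <= phi v] fails for large a. *)
have /choice[bad badP] a : exists b, ((b < a)%O /\ (a <= phi b)%O) \/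
    (b = a /\ forall c, (c < a)%O -> (phi c < a)%O).
  case: (pselect (exists b, (b < a)%O /\ (a <= phi b)%O)) => [[b bP]|nb].
    by exists b; left.
  exists a; right; split=> // c ca; rewrite ltNge; apply/negP => ac; apply: nb.
  by exists c.
pose D a (j : unit + (unit + (nat * K + nat * K))) := match j with
  | inl _ => bad a
  | inr (inl _) => w (N a)
  | inr (inr (inl ib)) => W a ib.1 ib.2
  | inr (inr (inr ib)) => Z a ib.1 ib.2
  end.
have sNK : small K (nat * K) := small_prod wcK fP (small_nat wcK) (small_K (K := K)).
have sJ := small_sum wcK fP (small_unit (K := K))
  (small_sum wcK fP (small_unit (K := K)) (small_sum wcK fP sNK sNK)).
have sI := small_prod wcK fP (small_seq wcK fP sJ) (small_sum wcK fP (small_K (K := K)) sJ).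
have [H uH HD] := wc_normal wcK D sJ sI.
have gtH b : evt H (fun a => (b < a)%O).
  have [b' bb'] := wc_nomax wcK b.
  by apply: evt_impl (evt_ge H b') => a _; exact: lt_le_trans.
have clH : evt H (closed_under phi).
  have := HD (inl tt); rewrite /D => -[[v vP]|geP].
    apply: evt_impl (evt_and (gtH \bot%O) (evt_and (gtH (phi v)) vP)) => a _ [a0 [va av]].
    split=> [ab|]; first by move: a0; rewrite ab ltxx.
    by case: (badP a) => -[] // _; rewrite av leNgt va.
  apply: evt_impl (evt_and (gtH \bot%O) geP) => a _ [a0 ga].
  split=> [ab|]; first by move: a0; rewrite ab ltxx.
  by case: (badP a) => -[] // ba; move: ga; rewrite leNgt ba.
have specH : evt H (fun a => spec a (N a) (W a) (Z a)).
  by apply: evt_impl (evt_and clH (gtH b0)) => a _ [ca ba]; exact: dataP.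
(* Lengths are coded by [w], whose values stay below [b1], so normality makes them constant. *)
have [n nP] : exists n, evt H (fun a => N a = n).
  have := HD (inr (inl tt)); rewrite /D => -[[v vP]|geP].
    have [a _ av] := evt_ex uH vP; exists (N a).
    by apply: evt_impl vP => c _ cv; apply: winj; rewrite cv av.
  have [a _ [ba]] := evt_ex uH (evt_and (gtH b1) geP).
  by rewrite leNgt (lt_trans (wb1 _) ba).
(* Values at a fixed place are regressive, hence eventually constant; completeness turns this into
   agreement below any c. *)
have limP (V : K -> nat -> K -> K) :
    evt H (fun a => forall i b, (b < a)%O -> (V a i b < a)%O) ->
    (forall i b, (exists v : K, evt H (fun a => V a i b = v)) \/
       evt H (fun a => (a <= V a i b)%O)) ->
    exists Vl : nat -> K -> K, forall i c, evt H (fun a => agree c (V a i) (Vl i)).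
  move=> Va VD; have /choice[Vl VlP] : forall ib : nat * K, exists v : K,
      evt H (fun a => V a ib.1 ib.2 = v).
    move=> [i b]; case: (VD i b) => // gV.
    have [a _ [[/(_ i b) + ba]]] := evt_ex uH (evt_and (evt_and Va (gtH b)) gV).
    by move=> /(_ ba); rewrite ltNge => /negP.
  exists (fun i b => Vl (i, b)) => i c.
  by apply: (evt_below wcK) => b _; exact: (VlP (i, b)).
have [|i b|Wl WlP] := limP W.
- by apply: evt_impl specH => a _ [WZ _ _ _] i b /(WZ i)[].
- exact: (HD (inr (inr (inl (i, b))))).
have [|i b|Zl ZlP] := limP Z.
- by apply: evt_impl specH => a _ [WZ _ _ _] i b /(WZ i)[].
- exact: (HD (inr (inr (inr (i, b))))).
exists n, Wl; split.
- apply/funext => b; have [b' bb'] := wc_nomax wcK b.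
  have [a _ [[[_ xW _ _] ba] aWl]] := evt_ex uH (evt_and (evt_and specH (gtH b)) (WlP 0%N b')).
  by rewrite -aWl// xW.
- apply/funext => b; have [b' bb'] := wc_nomax wcK b.
  have [a _ [[[[_ _ Wy _] ba] aWl] an]] :=
    evt_ex uH (evt_and (evt_and (evt_and specH (gtH b)) (WlP n b')) nP).
  by rewrite -aWl// -[in LHS]an Wy.
- move=> i lt_in; apply/RT.2; exists (Zl i) => c.
  have [a _ [[[_ _ _ WT] ca] [[W1 W2] [Z1 an]]]] := evt_ex uH (evt_and (evt_and specH (gtH c))
    (evt_and (evt_and (WlP i c) (WlP i.+1 c)) (evt_and (ZlP i c) nP))).
  by apply: RT.1 (WT i _ c ca) => //; rewrite an.
Qed.

Definition guess_char (o : K) x : baire K := fun a => if `[< chain a (f a) x >] then o else \bot%O.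

Lemma ones_guess_char o x a : is_one o -> ones (guess_char o x) a <-> chain a (f a) x.
Proof.
move=> oP; rewrite /ones/= /guess_char; case: asboolP => [|nch]; split=> // h.
by have := (h \bot%O).2 erefl; rewrite ltxx.
Qed.

Lemma guess_char_cantor o x : is_one o -> cantor (guess_char o x).
Proof. by move=> oP a; rewrite /guess_char; case: ifP; [right|left]. Qed.

(** Continuity of the reduction, in Lipschitz form. *)
Lemma guess_char_agree o a x y : agree a x y ->
  forall b, (b < a)%O -> guess_char o y b = guess_char o x b.
Proof.
move=> xy b ba; have xyb : agree b x y by apply: agree_le xy; exact: ltW.
rewrite /guess_char; congr (if _ then _ else _); apply/asbool_equiv_eq.
by split; apply: chain_agree => //; exact: agree_sym.
Qed.

Lemma guess_char_monotone o x y (P : set K) : is_one o -> R x y ->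
  sub_mod P (guess_char o x) (guess_char o y).
Proof.
move=> oP /RT.2[z zT]; apply/(stationaryPn wcK).
exists (fun b => Order.max (y b) (z b)) => a /closed_under_max[ya za].
move=> [[/ones_guess_char xa ya'] _]; apply: ya'; apply/ones_guess_char => //.
by apply: chain_step zT ya za _; exact: xa.
Qed.

Lemma guess_char_reflect o x y (P : set K) : is_one o -> @reg d K `<=` P ->
  sub_mod P (guess_char o x) (guess_char o y) ->
  exists n (W : nat -> K -> K), [/\ W 0%N = x, W n = y &
    forall i, (i < n)%N -> R (W i) (W i.+1)].
Proof.
move=> oP regP /(stationaryPn wcK)[phi phiP].
have [w winj] := wc_omega wcK; have [b0 wb0] := wc_bound_nat wcK w.
(* The clause [b0 < a] places any point where S reflects above a copy of omega, so a regular such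
   point is uncountable. *)
pose S := [set a | (b0 < a)%O /\ ~ chain a x y].
have [sS|/(stationaryPn wcK)[psi psiP]] := pselect (stationary S); last first.
  apply: (@chain_limit psi b0) => a aphi ba; apply: contrapT => nch.
  by apply: (psiP a).
exfalso.
have /(stationaryP wcK)/(_ (fun b => Order.max (phi b) (x b))) := fP x sS.
move=> [a [ra xa sa] /closed_under_max[aphi ax]].
(* Since f guesses x at a, the trivial chain puts a into the image of x; it remains to refute a
   chain from the guess to y. *)
apply: (phiP a aphi); split; last exact: regP.
split; first by apply/ones_guess_char => //; apply: chain_agree (chain_refl ax).
move=> /ones_guess_char-/(_ oP) ch.
have {}ch : chain a x y by apply: chain_agree ch => // b ba; rewrite xa.
have [|b' [[[b0b' _] /= b'a] _]] := sa (below a).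
  by split=> // b ba; exists b.
have rega := regular_segment_reg winj wb0 (lt_trans b0b' b'a) ra.
have [psi psia psiP] := chain_restrict rega ch.
have [b [[[_ nch] _] [/= ba' bpsi]]] := sa _ (club_closed_under wcK rega psia).
by apply: nch; exact: psiP.
Qed.

End Chains.

(** * Completeness of both quasi-orders *)

Section Completeness.
Context {d : Order.disp_t} {K : bOrderType d}.
Context (wcK : weakly_compact K).
Context (f : K -> K -> K) (fP : guessing f).

Lemma ex_is_one : exists o : K, is_one o.
Proof.
have [a a0] := wc_nomax wcK \bot%O.
have [o o0 omin] := @ex_least _ _ [set b | (\bot < b)%O] a (wc_wf wcK) a0.
exists o => b; split=> [bo|->//]; apply/eqP; rewrite -[_ == _]negbK -lt0x.
by apply/negP => /omin; rewrite leNgt bo.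
Qed.

Lemma borel_cantor : borel (@cantor d K).
Proof.
rewrite (_ : cantor = \bigcap_(i : K) [set eta : baire K | eta i = \bot%O \/ is_one (eta i)]).
  apply: borel_bigcap => i; apply: (borel_cylinders wcK fP) => x xi.
  by have [a ia] := wc_nomax wcK i; exists a => y /(_ i ia) /= ->.
by apply/seteqP; split=> x xP i; [move=> _; exact: xP|exact: xP].
Qed.

Lemma sub_mod_complete (P : set K) : @reg d K `<=` P ->
  Sigma11_complete (@cantor d K) (sub_mod P).
Proof.
move=> regP; split; [exact: borel_cantor|exact: sub_mod_quasi_order|].
move=> X Q bX [Qrefl Qtrans] /(Sigma11_tree wcK fP bX)[T RT].
have [o oP] := ex_is_one; exists (guess_char f T o); last first.
  move=> x y Xx Xy; split=> [Qxy|].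
    by apply: (guess_char_monotone wcK RT) => //; split.
  move=> /(guess_char_reflect wcK fP RT oP regP)[n [W [W0 Wn WR]]].
  (* The chain collapses to one instance of Q by reflexivity, which covers length zero, and
     transitivity. *)
  suff H m : (m <= n)%N -> X (W m) /\ Q x (W m) by rewrite -Wn; exact: (H n (leqnn n)).2.
  elim: m => [_|m IH mn]; first by rewrite W0; split=> //; exact: Qrefl.
  have [Xm Q0m] := IH (ltnW mn); have [_ Xm1 Qm] := WR m mn.
  by split=> //; exact: Qtrans Q0m Qm.
split=> [x _|U oU]; first exact: guess_char_cantor.
apply: (borel_setI wcK bX); apply: (borel_cylinders wcK fP) => x Ux.
have [a aU] := open_cylinder oU Ux; exists a => y xy; apply: aU => b.
by apply: guess_char_agree; exact: agree_sym.
Qed.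

End Completeness.

Theorem theorem5p7 (d : Order.disp_t) (K : bOrderType d) (G : K -> graph K) :
  weakly_compact K ->
  enumerates_graphs G ->
  WCstar G ->
  Sigma11_complete (@cantor d K) (@sub_reg d K) /\
  Sigma11_complete (@cantor d K) (@sub_NS d K).
Proof.
move=> wcK enumG /(WCstar_guessing enumG)[f fP]; split.
  exact: (sub_mod_complete wcK fP (P := @reg d K)).
rewrite (_ : sub_NS = sub_mod setT); first exact: (sub_mod_complete wcK fP).
by apply/funext => x; apply/funext => y; rewrite /sub_mod setIT.
Qed.
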